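(* Let $F$ be a field of characteristic $p>0$. 1. If $G$ is an arbitrary finite group, then the group algebra $FG$ is a centrally essential ring if and only if $G=P\times H$, where $P$ is the unique Sylow $p$-subgroup of the group $G$, the group $H$ is commutative, and the ring $FP$ is centrally essential. 2. If $G$ is a finite $p$-group and the nilpotence class of $G$ does not exceed $2$, then the group algebra $FG$ is a centrally essential ring. 3. There exists a group $G$ of order $p^5$ such that the group algebra $FG$ is not a centrally essential ring.
   Context: All rings are associative and unital. For a ring $R$ with center $C=C(R)$, $R$ is called centrally essential if the right $C$-module $R_C$ is an essential extension of the module $C_C$; equivalently, for every $0\neq r\in R$ there exists $c\in C$ such that $0\neq rc\in C$. For a group $G$, the upper central series is $\{e\}=Z_0(G)\subseteq Z_1(G)\subseteq\ldots$, where $Z_i(G)/Z_{i-1}(G)$ is the center of $G/Z_{i-1}(G)$ for $i\geq 1$; the nilpotence class of $G$ is the least positive integer $n$ with $Z_n(G)=G$ (if it exists). In part 1, $G=P\times H$ means that $G$ is the internal direct product of its subgroups $P$ and $H$. *)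

(* Defs.v *)
From HB Require Import structures.
From mathcomp Require Import all_boot all_order all_algebra all_fingroup.
From mathcomp Require Import all_solvable.

Set Implicit Arguments.
Unset Strict Implicit.
Unset Printing Implicit Defensive.

Import GroupScope GRing.Theory.
Local Open Scope ring_scope.

Definition central (R : nzRingType) (c : R) : Prop :=
  forall x : R, c * x = x * c.

Definition centrally_essential (R : nzRingType) : Prop :=
  forall r : R, r != 0 ->
    exists c : R, [/\ central c, r * c != 0 & central (r * c)].

(* The module form of the definition: every nonzero C(R)-submodule N of R
   meets the center C(R) nontrivially. *)
Lemma centrally_essentialP (R : nzRingType) :
  centrally_essential R <->
  (forall N : R -> Prop,
     N 0 -> (forall x y, N x -> N y -> N (x + y)) ->
     (forall x c, N x -> central c -> N (x * c)) ->
     (exists2 x, N x & x != 0) ->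
     exists x, [/\ N x, x != 0 & central x]).
Proof.
split=> [ceR N _ _ NZ [x Nx /ceR[c [cC xc0 xcC]]]|subR r r0].
  by exists (x * c); split=> //; apply: NZ.
case: (subR (fun x => exists2 c, central c & x = r * c)).
- by exists 0; rewrite ?mulr0 // => x; rewrite mul0r mulr0.
- move=> _ _ [c cC ->] [d dC ->]; exists (c + d); rewrite ?mulrDr //.
  by move=> x; rewrite mulrDl mulrDr cC dC.
- move=> _ d [c cC ->] dC; exists (c * d); rewrite ?mulrA //.
  by move=> x; rewrite -mulrA dC mulrA cC mulrA.
- by exists r => //; exists 1; rewrite ?mulr1 // => x; rewrite mul1r mulr1.
- by move=> _ [[c cC ->] rc0 rcC]; exists c.
Qed.

(* The group algebra F[gT]: u stands for the formal sum of the u g * g.  It is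
   a new type, not an alias of {ffun gT -> F}, because the latter already
   carries the pointwise product. *)
Record galg (F : fieldType) (gT : finGroupType) :=
  Galg { galg_coef : {ffun gT -> F} }.

HB.instance Definition _ (F : fieldType) (gT : finGroupType) :=
  [isNew for @galg_coef F gT].
HB.instance Definition _ (F : fieldType) (gT : finGroupType) :=
  [Choice of galg F gT by <:].

Section GroupAlgebra.
Variables (F : fieldType) (gT : finGroupType).
Local Notation A := (galg F gT).
Implicit Types (u v w : A) (g h : gT) (a b : F).

Local Notation coef := (@galg_coef F gT).

Lemma galgP u v : (forall g, coef u g = coef v g) <-> u = v.
Proof. by split=> [uv|->//]; apply: val_inj; apply/ffunP. Qed.

Definition galg_zero : A := Galg 0.
Definition galg_opp u : A := Galg (- coef u).
Definition galg_add u v : A := Galg (coef u + coef v).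
Definition galg_scale a u : A := Galg [ffun g => a * coef u g].
Definition galg_one : A := Galg [ffun g => (g == 1%g)%:R].
Definition galg_mul u v : A :=
  Galg [ffun g => \sum_(h : gT) coef u h * coef v (h^-1 * g)%g].

Fact galg_addA : associative galg_add.
Proof. by move=> u v w; apply/val_inj; exact: addrA. Qed.
Fact galg_addC : commutative galg_add.
Proof. by move=> u v; apply/val_inj; exact: addrC. Qed.
Fact galg_add0 : left_id galg_zero galg_add.
Proof. by move=> u; apply/val_inj; exact: add0r. Qed.
Fact galg_addN : left_inverse galg_zero galg_opp galg_add.
Proof. by move=> u; apply/val_inj; exact: addNr. Qed.

HB.instance Definition _ :=
  GRing.isZmodule.Build A galg_addA galg_addC galg_add0 galg_addN.

Lemma coef0 g : coef 0 g = 0. Proof. by rewrite ffunE. Qed.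
Lemma coefN u g : coef (- u) g = - coef u g. Proof. by rewrite ffunE. Qed.
Lemma coefD u v g : coef (u + v) g = coef u g + coef v g.
Proof. by rewrite ffunE. Qed.

Fact galg_mulA : associative galg_mul.
Proof.
move=> u v w; apply/galgP => g; rewrite !ffunE.
under eq_bigr => h _ do rewrite ffunE mulr_sumr.
under [RHS]eq_bigr => h _ do rewrite ffunE mulr_suml.
rewrite [RHS]exchange_big /=; apply: eq_bigr => h _.
rewrite [RHS](reindex_inj (mulgI h)) /=; apply: eq_bigr => k _.
by rewrite mulrA invMg mulKg mulgA.
Qed.

Fact galg_mul1l : left_id galg_one galg_mul.
Proof.
move=> u; apply/galgP => g; rewrite ffunE (bigD1 1%g) //= ffunE eqxx.
rewrite mul1r invg1 mul1g big1 ?addr0 // => h /negbTE h1.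
by rewrite ffunE h1 mul0r.
Qed.

Fact galg_mul1r : right_id galg_one galg_mul.
Proof.
move=> u; apply/galgP => g; rewrite ffunE (bigD1 g) //= ffunE mulVg eqxx.
rewrite mulr1 big1 ?addr0 // => h /negbTE hg.
by rewrite ffunE -eq_mulVg1 hg mulr0.
Qed.

Fact galg_mulDl : left_distributive galg_mul +%R.
Proof.
move=> u v w; apply/galgP => g; rewrite coefD !ffunE -big_split /=.
by apply: eq_bigr => h _; rewrite coefD mulrDl.
Qed.

Fact galg_mulDr : right_distributive galg_mul +%R.
Proof.
move=> u v w; apply/galgP => g; rewrite coefD !ffunE -big_split /=.
by apply: eq_bigr => h _; rewrite coefD mulrDr.
Qed.

Fact galg_one_neq0 : galg_one != 0.
Proof.
by apply/eqP => /galgP/(_ 1%g)/eqP; rewrite coef0 ffunE eqxx oner_eq0.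
Qed.

HB.instance Definition _ := GRing.Zmodule_isNzRing.Build A
  galg_mulA galg_mul1l galg_mul1r galg_mulDl galg_mulDr galg_one_neq0.

Lemma coef1 g : coef 1 g = (g == 1%g)%:R. Proof. by rewrite ffunE. Qed.
Lemma coefM u v g : coef (u * v) g = \sum_h coef u h * coef v (h^-1 * g)%g.
Proof. by rewrite ffunE. Qed.

Fact galg_scaleA a b u : galg_scale a (galg_scale b u) = galg_scale (a * b) u.
Proof. by apply/galgP => g; rewrite !ffunE mulrA. Qed.
Fact galg_scale1 : left_id 1 galg_scale.
Proof. by move=> u; apply/galgP => g; rewrite ffunE mul1r. Qed.
Fact galg_scaleDr : right_distributive galg_scale +%R.
Proof. by move=> a u v; apply/galgP => g; rewrite coefD !ffunE mulrDr. Qed.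
Fact galg_scaleDl u : {morph galg_scale^~ u : a b / a + b}.
Proof. by move=> a b; apply/galgP => g; rewrite coefD !ffunE mulrDl. Qed.

HB.instance Definition _ := GRing.Zmodule_isLmodule.Build F A
  galg_scaleA galg_scale1 galg_scaleDr galg_scaleDl.

Lemma coefZ a u g : coef (a *: u) g = a * coef u g.
Proof. by rewrite ffunE. Qed.

Fact galg_scaleAl a u v : a *: (u * v) = (a *: u) * v.
Proof.
apply/galgP => g; rewrite coefZ !coefM mulr_sumr.
by apply: eq_bigr => h _; rewrite coefZ mulrA.
Qed.
HB.instance Definition _ := GRing.Lmodule_isLalgebra.Build F A galg_scaleAl.

Fact galg_scaleAr a u v : a *: (u * v) = u * (a *: v).
Proof.
apply/galgP => g; rewrite coefZ !coefM mulr_sumr.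
by apply: eq_bigr => h _; rewrite coefZ mulrCA.
Qed.
HB.instance Definition _ := GRing.Lalgebra_isAlgebra.Build F A galg_scaleAr.

Definition galg_base g : A := Galg [ffun h => (h == g)%:R].

Lemma galg_base1 : galg_base 1%g = 1. Proof. by []. Qed.

Lemma galg_baseM g h : galg_base (g * h)%g = galg_base g * galg_base h.
Proof.
apply/galgP => k; rewrite coefM (bigD1 g) //= !ffunE eqxx mul1r.
rewrite big1 => [|x /negbTE xg]; last by rewrite ffunE xg mul0r.
by rewrite addr0 (canF_eq (mulKVg g)).
Qed.

Lemma galg_sum_base u : u = \sum_g coef u g *: galg_base g.
Proof.
apply/galgP => k.
rewrite (big_morph (fun w => coef w k) (fun w1 w2 => coefD w1 w2 k) (coef0 k)).
under eq_bigr do rewrite coefZ ffunE.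
rewrite (bigD1 k) //= eqxx mulr1 big1 ?addr0 // => g.
by rewrite eq_sym => /negbTE->; rewrite mulr0.
Qed.

End GroupAlgebra.

(* Main.v *)
Require Import Defs.
From HB Require Import structures.
From mathcomp Require Import all_boot all_order all_algebra all_fingroup.
From mathcomp Require Import all_solvable.
From mathcomp Require Import ring.

Set Implicit Arguments.
Unset Strict Implicit.
Unset Printing Implicit Defensive.

Import GroupScope GRing.Theory.
(* The coefficient lemmas of the group algebra must take precedence over the
   polynomial ones that bear the same names. *)
Import Defs.

(** Everything is computed in the group algebra F[gT] of the ambient group: for
    a subgroup K, the algebra FK is the set of elements supported on K, and such
    an element is central in FK exactly when its coefficients are constant on
    the K-conjugacy classes ([ce_inP]).

    Part 1. Suppose FG is centrally essential, and let y be a p'-element of G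
    and x any element. If xy - yx is nonzero, some multiple z = (xy - yx)c with
    c central is nonzero and central; but z = ay - ya for a = xc. As z commutes
    with y, the derivation u |-> au - ua sends y^n to n y^(n-1) z, and taking n
    to be the order of y gives n y^(n-1) z = 0 with n invertible in F and y
    invertible, so z = 0, a contradiction ([ce_in_p'elt_central]). Hence all the
    p'-elements are central, G modulo its center is a p-group, and G is
    nilpotent: it is the product of its Sylow p-subgroup P and of an abelian
    p'-group H ([central_p'elts_dprod]). When G = P x H with H abelian, FG is
    the group ring of H over FP, and passing to the coefficients in FP of the
    elements of H carries central essentiality from FG to FP
    ([ce_in_dprodl]); conversely, the coefficients of an element of FG can be
    multiplied into the center of FP one after the other ([ce_in_dprod]).

    Part 2. In a p-group, z - 1 is nilpotent for every z. So any nonzero r can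
    be multiplied by powers of the z - 1, with z in the center Z of G, until the
    product is nonzero and killed by all these z - 1, that is, until its
    coefficients are constant on the cosets of Z. In class at most 2 the
    conjugates of an element all lie in its coset of Z, so such a product is
    central ([ce_in_class2]).

    Part 3. Let A = K[X]/(X^3) for a field K with p elements and let G be the
    group of the affine maps t |-> a + u t of A with u in 1 + XA. The group has
    order p^5 and its center Z consists of the translations by a multiple of
    X^2. Every noncentral g is conjugate to all the elements of gZ
    ([conj_noncentral]). If c is central in FG and s is the sum of the elements
    of Z, it follows that the coefficients of sc vanish outside Z, where each is
    p times a coefficient of c, and thus that sc is a scalar multiple of s. So
    the multiples rc of r = sg by central elements c are scalar multiples of r;
    yet r is not central when g is the translation by 1, because the class of g
    is not contained in gZ ([not_ce_in_affine]). *)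

(** * Supports and class functions *)

Section Support.
Local Open Scope ring_scope.
Variables (F : fieldType) (gT : finGroupType).
Local Notation A := (galg F gT).
Local Notation coef := (@galg_coef F gT).
Local Notation base := (@galg_base F gT).
Implicit Types (u v w r c : A) (g h k x y : gT) (K L : {group gT}).

Definition supported K u := forall g, g \notin K -> coef u g = 0.

(** For u supported on K, this says that u lies in the center of FK; it also makes
    sense for an element of the larger algebra F[gT]. *)
Definition class_fun K u := forall g k, k \in K -> coef u (g ^ k)%g = coef u g.

Lemma coef_base g h : coef (base g) h = (h == g)%:R.
Proof. by rewrite ffunE. Qed.

Lemma coefMr u v g : coef (u * v) g = \sum_h coef u (g * h^-1)%g * coef v h.
Proof.
rewrite coefM (reindex_inj invg_inj) (reindex_inj (mulIg g^-1)%g) /=.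
by apply: eq_bigr => h _; rewrite !invMg !invgK mulgKV.
Qed.

Lemma coef_base_mul k u g : coef (base k * u) g = coef u (k^-1 * g)%g.
Proof.
rewrite coefM (bigD1 k) //= coef_base eqxx mul1r big1 ?addr0 // => h /negbTE hk.
by rewrite coef_base hk mul0r.
Qed.

Lemma coef_mul_base u k g : coef (u * base k) g = coef u (g * k^-1)%g.
Proof.
rewrite coefMr (bigD1 k) //= coef_base eqxx mulr1.
by rewrite big1 ?addr0 // => h /negbTE hk; rewrite coef_base hk mulr0.
Qed.

Lemma galg_base_inj : injective base.
Proof.
move=> g h /galgP/(_ g)/eqP; rewrite !coef_base eqxx.
by case: (g =P h) => // _; rewrite oner_eq0.
Qed.

Lemma galg_baseX g n : base (g ^+ n)%g = base g ^+ n.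
Proof.
by elim: n => [|n IHn]; rewrite ?galg_base1 // expgS galg_baseM exprS IHn.
Qed.

Lemma supported_base K g : g \in K -> supported K (base g).
Proof.
by move=> gK h; rewrite coef_base; case: eqP => // ->; rewrite gK.
Qed.

Lemma supportedB K u v : supported K u -> supported K v -> supported K (u - v).
Proof. by move=> su sv g gK; rewrite coefD coefN su ?sv // subr0. Qed.

Lemma supportedM K u v : supported K u -> supported K v -> supported K (u * v).
Proof.
move=> su sv g gK; rewrite coefM big1 // => h _.
have [hK|/su->] := boolP (h \in K); last by rewrite mul0r.
by rewrite sv ?mulr0 // groupMl ?groupV.
Qed.

Lemma supportedX K u n : supported K u -> supported K (u ^+ n).
Proof.
move=> su; elim: n => [|n IHn]; last by rewrite exprS; apply: supportedM.
exact: supported_base (group1 K).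
Qed.

Lemma supported_sub K L u : K \subset L -> supported K u -> supported L u.
Proof. by move=> /subsetP sKL su g gL; apply/su/(contra (sKL g)). Qed.

Lemma class_funB K u v : class_fun K u -> class_fun K v -> class_fun K (u - v).
Proof. by move=> cu cv g k kK; rewrite !coefD !coefN cu ?cv. Qed.

Lemma class_funM K u v : class_fun K u -> class_fun K v -> class_fun K (u * v).
Proof.
move=> cu cv g k kK; rewrite !coefM (reindex_inj (conjg_inj k)) /=.
by apply: eq_bigr => h _; rewrite -conjVg -conjMg cu ?cv.
Qed.

Lemma class_fun_base K g : g \in 'C(K)%g -> class_fun K (base g).
Proof.
move=> gC h k kK.
have gk : (g ^ k)%g = g by apply/conjg_fixP/commgP/(centP gC).
by rewrite !coef_base -[in LHS]gk (inj_eq (conjg_inj k)).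
Qed.

Lemma class_funX K u n : class_fun K u -> class_fun K (u ^+ n).
Proof.
move=> cu; elim: n => [|n IHn]; last by rewrite exprS; apply: class_funM.
exact: class_fun_base (group1 _).
Qed.

(** Only a conjugation by an element of K is used to exchange the two factors, so
    u itself may have a support larger than K. *)
Lemma class_fun_comm K u v : class_fun K u -> supported K v -> u * v = v * u.
Proof.
move=> cu sv; apply/galgP => g; rewrite coefMr coefM; apply: eq_bigr => h _.
have [hK|/sv->] := boolP (h \in K); last by rewrite mul0r mulr0.
by rewrite mulrC -[RHS]mulrC -(cu _ h hK) conjgE !mulgA mulgKV mulrC.
Qed.

Lemma comm_base_coef u k g :
  u * base k = base k * u -> coef u (g ^ k)%g = coef u g.
Proof.
move=> /galgP/(_ (g * k)%g); rewrite coef_mul_base coef_base_mul mulgK.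
by rewrite conjgE mulgA.
Qed.

Lemma supported_setT u : supported [group of setT] u.
Proof. by move=> g; rewrite inE. Qed.

Lemma centralP u : central u <-> class_fun [group of setT] u.
Proof.
split=> [cu g k _|cu v]; last exact: class_fun_comm (supported_setT v).
exact: comm_base_coef (cu _).
Qed.

(** Central essentiality of FK, with FK viewed inside F[gT]. *)
Definition ce_in K := forall r, supported K r -> r != 0 ->
  exists c, [/\ supported K c, class_fun K c, r * c != 0 & class_fun K (r * c)].

Lemma galg_neq0P u : reflect (exists g, coef u g != 0) (u != 0).
Proof.
apply: (iffP idP) => [|[g]]; last by apply: contraNneq => ->; rewrite coef0.
move=> u0; apply/existsP; apply: contraNT u0; rewrite negb_exists.
move=> /forallP u0; apply/eqP/galgP => g; rewrite coef0; apply/eqP.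
by rewrite -[_ == _]negbK.
Qed.

End Support.

(** * The algebra of a subgroup as a set of supported elements *)

Section Restriction.
Local Open Scope ring_scope.
Variables (F : fieldType) (gT : finGroupType) (K : {group gT}).
Local Notation B := (galg F (subg_of K)).

Definition galg_res (u : galg F gT) : B :=
  Galg [ffun x => galg_coef u (sgval x)].

Definition galg_ext (v : B) : galg F gT :=
  Galg [ffun g => if g \in K then galg_coef v (subg K g) else 0].

Let sgvalJ (x y : subg_of K) : sgval (x ^ y)%g = (sgval x ^ sgval y)%g.
Proof. by []. Qed.

Lemma coef_res u x : galg_coef (galg_res u) x = galg_coef u (sgval x).
Proof. by rewrite ffunE. Qed.

Lemma supported_ext v : supported K (galg_ext v).
Proof. by move=> g /negbTE gK; rewrite ffunE gK. Qed.

Lemma galg_extK : cancel galg_ext galg_res.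
Proof. by move=> v; apply/galgP => x; rewrite !ffunE subgP sgvalK. Qed.

Lemma galg_resM u v : supported K u ->
  galg_res (u * v) = galg_res u * galg_res v.
Proof.
move=> su; apply/galgP => x; rewrite coef_res !coefM.
rewrite (bigID (mem K)) /= [X in _ + X]big1 ?addr0 => [|g /su->]; last first.
  by rewrite mul0r.
rewrite (reindex_onto sgval (subg K)) /= => [|g]; last exact: subgK.
apply: eq_big => [y|y _]; first by rewrite subgP sgvalK eqxx.
by rewrite !coef_res.
Qed.

Lemma galg_res_neq0 u : supported K u -> (galg_res u != 0) = (u != 0).
Proof.
move=> su; apply/galg_neq0P/galg_neq0P => -[g].
  by rewrite coef_res => ?; exists (sgval g).
have [gK|/su->] := boolP (g \in K); last by rewrite eqxx.
by exists (subg K g); rewrite coef_res subgK.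
Qed.

Lemma central_res u : supported K u -> central (galg_res u) <-> class_fun K u.
Proof.
move=> su; split=> [/centralP cu g k kK|cu]; last first.
  by apply/centralP=> x y _; rewrite !coef_res sgvalJ cu ?subgP.
have [gK|gK] := boolP (g \in K); last by rewrite !su ?memJ_norm ?(subsetP (normG K)).
have := cu (subg K g) (subg K k) (in_setT _).
by rewrite !coef_res sgvalJ !subgK.
Qed.

Lemma ce_inP : centrally_essential B <-> ce_in F K.
Proof.
split=> [ceB r sr r0|ceK v v0].
  have [|d [dC rd0 rdC]] := ceB (galg_res r); first by rewrite galg_res_neq0.
  have sd := supported_ext d.
  have src : supported K (r * galg_ext d) by apply: supportedM.
  exists (galg_ext d); split=> //.
  - by apply/central_res; rewrite ?galg_extK.
  - by rewrite -galg_res_neq0 // galg_resM // galg_extK.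
  - by apply/central_res; rewrite // galg_resM // galg_extK.
have sv := supported_ext v.
have [|c [sc cC vc0 vcC]] := ceK _ sv; first by rewrite -galg_res_neq0 ?galg_extK.
have svc : supported K (galg_ext v * c) by apply: supportedM.
exists (galg_res c); rewrite -[v]galg_extK -galg_resM //.
by split; rewrite ?galg_res_neq0 //; apply/central_res.
Qed.

End Restriction.

(** * Centrality of the p'-elements *)

Section CommutatorPowers.
Local Open Scope ring_scope.

(** The derivation u |-> a u - u a acts on the powers of y like a usual derivative
    as soon as its value at y commutes with y. *)
Lemma comm_commutator_pow (R : nzRingType) (a y : R) n :
    (a * y - y * a) * y = y * (a * y - y * a) ->
  a * y ^+ n.+1 - y ^+ n.+1 * a = (y ^+ n * (a * y - y * a)) *+ n.+1.
Proof.
set z := a * y - y * a => zy.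
have zyn m : z * y ^+ m = y ^+ m * z.
  by elim: m => [|m IHm]; rewrite ?mulr1 ?mul1r // exprSr mulrA IHm -mulrA zy mulrA.
elim: n => [|n IHn]; first by rewrite !expr1 expr0 mul1r.
rewrite mulrSr exprS -{1}zyn mulrA.
rewrite -[LHS](subrKA (y * a * y ^+ n.+1)) -mulrBl -/z zyn -!mulrA.
by rewrite -mulrBr IHn -mulrnAr mulrA -exprS addrC mulrnAr.
Qed.

End CommutatorPowers.

Section CentralP'Elements.
Local Open Scope ring_scope.
Variables (F : fieldType) (gT : finGroupType).
Local Notation A := (galg F gT).
Local Notation base := (@galg_base F gT).

(** If c and z = (xy - yx)c are central, then z is the value at y of an inner
    derivation, which yields z = 0 when applied to y^n = 1 with n prime to p. *)
Lemma ce_in_p'elt_central p (G : {group gT}) y :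
    p \in [pchar F] -> ce_in F G -> y \in G -> p^'.-elt y -> y \in 'Z(G)%g.
Proof.
move=> charFp ceG yG p'y; apply/setIP; split=> //; apply/centP => x xG.
apply/eqP/negPn/negP => xy.
have sb g : g \in G -> supported G (base g) by apply: supported_base.
case: (ceG (base x * base y - base y * base x)).
- by apply: supportedB; apply: supportedM; apply: sb.
- rewrite subr_eq0 -!galg_baseM; apply: contra xy => /eqP/galg_base_inj ->.
  by [].
move=> c [sc cc z0 zc]; set z := _ * c in z0 zc.
set a := base x * c.
have za : z = a * base y - base y * a.
  by rewrite /z mulrBl -!mulrA (class_fun_comm cc (sb _ yG)).
have zy : z * base y = base y * z by apply: class_fun_comm (sb _ yG).
have n_gt0 : (0 < #[y])%N by [].
have := @comm_commutator_pow _ a (base y) #[y].-1; rewrite -za => /(_ zy).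
rewrite prednK // -galg_baseX expg_order galg_base1 mulr1 mul1r subrr => /esym zn.
have n0 : #[y]%:R != 0 :> F.
  by rewrite -(dvdn_pcharf charFp) -p'natE // (pcharf_prime charFp).
case/eqP: z0.
have : base y * (base y ^+ #[y].-1 * z *+ #[y]) = 0 by rewrite zn mulr0.
rewrite mulrnAr mulrA -exprS prednK // -galg_baseX expg_order galg_base1 mul1r.
rewrite -scaler_nat => zn'; apply/eqP.
by rewrite -[z]scale1r -(mulVf n0) -scalerA zn' scaler0.
Qed.

End CentralP'Elements.

(** The p'-part of every element vanishes modulo the center, so that G is nilpotent
    and its p'-core, made of p'-elements, is central. *)
Lemma central_p'elts_dprod (gT : finGroupType) p (G : {group gT}) : prime p ->
    (forall y, y \in G -> p^'.-elt y -> y \in 'Z(G)%g) ->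
  exists P H : {group gT},
    [/\ P \x H = G, 'Syl_p(G) = [set P] & abelian H]%g.
Proof.
move=> p_pr p'Z.
have nilG : nilpotent G.
  rewrite -quotient_center_nil; apply: (@pgroup_nil _ p).
  apply/pgroupP => q q_pr /(Cauchy q_pr)[_ /morphimP[x nx xG ->] oq].
  have : p.-elt (coset 'Z(G) x).
    have xp'Z : x.`_p^' \in 'Z(G)%g by rewrite p'Z ?p_elt_constt ?groupX.
    rewrite -(consttC p x) morphM /= ?(coset_id xp'Z) ?mulg1.
    - by apply: morph_p_elt; rewrite ?p_elt_constt ?groupX.
    - by rewrite groupX.
    - by rewrite groupX.
  by rewrite /p_elt oq pnatE.
have sylP := nilpotent_pcore_Hall p nilG.
exists 'O_p(G)%G, 'O_p^'(G)%G; split.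
- exact: nilpotent_pcoreC.
- apply/eqP; rewrite eqEsubset sub1set !inE sylP andbT.
  apply/subsetP => Q; rewrite !inE => sylQ; apply/eqP/val_inj => /=.
  exact: (nilpotent_Hall_pcore nilG sylQ).
- apply/subsetP => y yO; have yG := subsetP (pcore_sub _ _) y yO.
  have /setIP[_] := p'Z y yG (mem_p_elt (pcore_pgroup _ _) yO).
  exact/subsetP/centS/pcore_sub.
Qed.

(** * Direct products with an abelian factor *)

Section DirectProduct.
Local Open Scope ring_scope.
Variables (F : fieldType) (gT : finGroupType).
Local Notation A := (galg F gT).
Local Notation coef := (@galg_coef F gT).

Variables (P H G : {group gT}).
Hypothesis defG : (P \x H)%g = G.

(** The coefficient of h when FG is viewed as the group ring of H over FP. *)
Definition slice (h : gT) (u : A) : A :=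
  Galg [ffun g => if g \in P then coef u (g * h)%g else 0].

Lemma coef_slice h u g : g \in P -> coef (slice h u) g = coef u (g * h)%g.
Proof. by move=> gP; rewrite ffunE gP. Qed.

Lemma supported_slice h u : supported P (slice h u).
Proof. by move=> g /negbTE gP; rewrite ffunE gP. Qed.
Arguments supported_slice {h u}.

Lemma sliceM h u v : supported P u -> slice h (u * v) = u * slice h v.
Proof.
move=> su; apply/galgP => g.
have [gP|gP] := boolP (g \in P); last first.
  by rewrite (supportedM su supported_slice) // supported_slice.
rewrite coef_slice // !coefM; apply: eq_bigr => k _.
have [kP|/su->] := boolP (k \in P); last by rewrite !mul0r.
by rewrite coef_slice ?groupM ?groupV // mulgA.
Qed.

Lemma class_fun_slice h u : h \in H -> class_fun P u -> class_fun P (slice h u).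
Proof.
have [_ _ cPH _] := dprodP defG => hH cu g k kP.
have [gP|gP] := boolP (g \in P); last first.
  by rewrite !supported_slice // memJ_norm ?(subsetP (normG P)).
rewrite !coef_slice ?groupJ // -[RHS](cu _ k kP) conjMg.
by congr (coef u (_ * _)%g); apply/esym/conjg_fixP/commgP/(centsP cPH).
Qed.

Lemma slice_neq0 u : supported G u -> u != 0 ->
  exists2 h, h \in H & slice h u != 0.
Proof.
move=> su /galg_neq0P[g ug].
have gG : g \in G by apply: contraNT ug => /su->.
have [_ defG' _ _] := dprodP defG; move: gG; rewrite -defG' => /mulsgP[a h aP hH gE].
exists h => //; apply/galg_neq0P; exists a; rewrite coef_slice //.
by rewrite -gE.
Qed.

Lemma dprod_subl : P \subset G.
Proof. by have [_ <- _ _] := dprodP defG; apply: mulG_subl. Qed.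

Lemma ce_in_dprodl : ce_in F G -> ce_in F P.
Proof.
move=> ceG r sr r0.
have sPG := dprod_subl.
have [c [sc cc rc0 rcC]] := ceG r (supported_sub sPG sr) r0.
have subC u : class_fun G u -> class_fun P u.
  by move=> cu g k /(subsetP sPG); apply: cu.
have [h hH rh0] := slice_neq0 (supportedM (supported_sub sPG sr) sc) rc0.
exists (slice h c); rewrite -sliceM //.
split=> //; first exact: supported_slice.
  exact/class_fun_slice/subC.
exact/class_fun_slice/subC.
Qed.

(** H centralizes P and itself, so conjugation by an element bl of PH moves the
    P-component of an element only, and moves it as b does. *)
Lemma class_fun_centl u : abelian H -> supported G u ->
  (forall h, h \in H -> class_fun P (slice h u)) -> class_fun G u.
Proof.
move=> abH su cu g k kG.
have [gG|gG] := boolP (g \in G); last first.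
  by rewrite !su // memJ_norm ?(subsetP (normG G)).
have [_ defG' cPH _] := dprodP defG.
move: gG kG; rewrite -defG' => /mulsgP[a h aP hH ->] /mulsgP[b l bP lH ->].
have fixJ (x y : gT) : commute x y -> (x ^ y = x)%g.
  by move=> xy; apply/conjg_fixP/commgP.
have hb: commute h b by apply: (centsP cPH).
have hl: commute h l by apply: (centsP abH).
have al: commute (a ^ b)%g l.
  by apply/commute_sym/(centsP cPH) => //; apply: groupJ.
by rewrite conjgM (conjMg a h b) (conjMg (a ^ b)%g) (fixJ h b) //
  (fixJ h l) // (fixJ _ _ al) -(coef_slice _ _ aP) -(coef_slice _ _ (groupJ aP bP)) cu.
Qed.

(** Elements of FP which are central in FP are central in FG. Multiplying by such an
    element multiplies every slice by it, so the slices which are already central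
    remain so, and the next one can be treated. *)
Lemma ce_in_dprod : abelian H -> ce_in F P -> ce_in F G.
Proof.
move=> abH ceP r sr r0.
have sPG := dprod_subl.
have [_ defG' cPH _] := dprodP defG.
have extC (c : A) : supported P c -> class_fun P c -> class_fun G c.
  move=> sc cc g k; rewrite -defG' => /mulsgP[b l bP lH ->].
  rewrite conjgM -[RHS](cc _ b) //; move: (g ^ b)%g => x.
  have lx y : y \in P -> (y ^ l)%g = y.
    by move=> yP; apply/conjg_fixP/commgP/commute_sym/(centsP cPH).
  have [xP|xP] := boolP (x \in P); first by rewrite lx.
  rewrite !sc //; apply: contra xP => xlP.
  by rewrite -(conjgK l x) -[in X in (X ^ _)%g](lx _ xlP) conjgK.
have step (s : seq gT) : {subset s <= H} ->
  exists c, [/\ supported P c, class_fun P c, c * r != 0 &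
             {in s, forall h, class_fun P (slice h (c * r))}].
  elim: s => [|h s IHs] sH.
    exists 1; rewrite mul1r; split=> //; first exact: supported_base (group1 P).
    exact: class_fun_base (group1 _).
  have [x xs|c [sc cc cr0 crs]] := IHs; first by rewrite sH ?inE ?xs ?orbT.
  have [rh0|rh0] := eqVneq (slice h (c * r)) 0.
    exists c; split=> // x; rewrite inE => /predU1P[->|/crs//].
    by rewrite rh0 => g k _; rewrite !coef0.
  have [d [sd cd rd0 rdC]] := ceP _ (supported_slice (u := c * r) (h := h)) rh0.
  rewrite -(class_fun_comm cd (supported_slice (h := h))) in rd0 rdC.
  rewrite -sliceM // in rd0 rdC.
  exists (d * c); rewrite -!mulrA; split=> //; first exact: supportedM.
  - exact: class_funM.
  - apply: contraNneq rd0 => ->; apply/eqP/galgP => g.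
    by rewrite ffunE !coef0 if_same.
  - move=> x; rewrite inE => /predU1P[->//|/crs xC].
    by rewrite sliceM //; apply: class_funM.
have [|c [sc cc cr0 crH]] := step (enum H); first by move=> h; rewrite mem_enum.
have cG := extC c sc cc; have scG := supported_sub sPG sc.
exists c; rewrite -(class_fun_comm cG sr); split=> //.
apply: class_fun_centl => // [|h hH]; first exact: supportedM.
by apply: crH; rewrite mem_enum.
Qed.

End DirectProduct.

(** * Groups of class at most 2 *)

Section NilpotentClassTwo.
Local Open Scope ring_scope.
Variables (F : fieldType) (gT : finGroupType) (p : nat) (G : {group gT}).
Hypotheses (charFp : p \in [pchar F]) (pG : p.-group G).
Local Notation A := (galg F gT).
Local Notation coef := (@galg_coef F gT).
Local Notation base := (@galg_base F gT).

Lemma galg_pchar : p \in [pchar A].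
Proof. by apply: (rmorph_pchar (in_alg A)). Qed.

(** In characteristic p, the power of z - 1 with exponent p^e is z^(p^e) - 1. *)
Lemma galg_base_sub1_nilp z : z \in G -> exists n, (base z - 1) ^+ n = 0.
Proof.
move=> zG; have [e oz] := p_natP (mem_p_elt pG zG); exists (p ^ e)%N.
have -> : (base z - 1) ^+ (p ^ e) = base z ^+ (p ^ e) - 1.
  elim: e {oz} => [|e IHe]; first by rewrite !expr1.
  rewrite expnSr !exprM IHe -!(pFrobenius_autE galg_pchar).
  by rewrite pFrobenius_autB_comm ?pFrobenius_aut1 //; apply: commr1.
by rewrite -galg_baseX -oz expg_order galg_base1 subrr.
Qed.

(** For each z in turn, multiply by the last power of the nilpotent element z - 1
    that does not kill the product. *)
Lemma annihilate_center (s : seq gT) (r : A) :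
    {subset s <= 'Z(G)} -> r != 0 ->
  exists c, [/\ supported G c, class_fun G c, r * c != 0
            & {in s, forall z, r * c * (base z - 1) = 0}].
Proof.
move=> sZ r0; elim: s sZ => [|z s IHs] sZ.
  exists 1; rewrite mulr1; split=> //.
    exact: supported_base (group1 G).
  exact: class_fun_base (group1 _).
have [y ys|c [sc cc rc0 rcs]] := IHs; first by rewrite sZ ?inE ?ys ?orbT.
have /setIP[zG zC] : z \in 'Z(G) by rewrite sZ ?mem_head.
have sz: supported G (base z - 1).
  by apply: supportedB; [apply: supported_base | apply: supported_base (group1 G)].
have cz: class_fun G (base z - 1).
  by apply: class_funB; [apply: class_fun_base | apply: class_fun_base (group1 _)].
have [m rm0 rmS]: exists2 m, r * c * (base z - 1) ^+ m != 0
                           & r * c * (base z - 1) ^+ m.+1 = 0.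
  have ex: exists n, r * c * (base z - 1) ^+ n == 0.
    by have [n zn] := galg_base_sub1_nilp zG; exists n; rewrite zn mulr0.
  case: (ex_minnP ex) => -[|m] /eqP rm min.
    by case/eqP: rc0; rewrite -rm expr0 mulr1.
  by exists m => //; apply: contraTneq (ltnSn m) => /eqP/min; rewrite -leqNgt.
exists (c * (base z - 1) ^+ m); split; rewrite ?mulrA //.
- exact/supportedM/supportedX.
- exact/class_funM/class_funX.
move=> y; rewrite inE => /predU1P[->|ys]; first by rewrite -mulrA -exprSr.
have yZ : y \in 'Z(G) by rewrite sZ ?inE ?ys ?orbT.
have sy: supported G (base y - 1).
  have [yG _] := setIP yZ.
  by apply: supportedB; [apply: supported_base | apply: supported_base (group1 G)].
by rewrite -mulrA (class_fun_comm (class_funX m cz) sy) mulrA rcs // mul0r.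
Qed.

Lemma ce_in_class2 : (nil_class G <= 2)%N -> ce_in F G.
Proof.
rewrite nil_class2 => sG'Z r sr r0.
have [|c [sc cc rc0 rcZ]] := @annihilate_center (enum 'Z(G)) r _ r0.
  by move=> z; rewrite mem_enum.
exists c; split=> // g k kG.
have [gG|gG] := boolP (g \in G); last first.
  by rewrite !(supportedM sr sc) // memJ_norm ?(subsetP (normG G)).
have zZ: [~ g, k] \in 'Z(G) by rewrite (subsetP sG'Z) ?mem_commg.
have /rcZ/eqP : [~ g, k] \in enum 'Z(G) by rewrite mem_enum.
(* Being killed by z - 1 for z = [g, k] equates the coefficients of the product
   at g ^ k = g z and at g. *)
rewrite mulrBr mulr1 subr_eq0 => /eqP/galgP/(_ (g ^ k)%g).
by rewrite coef_mul_base conjg_mulR mulgK.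
Qed.

End NilpotentClassTwo.

(** * A group of order p^5 with large noncentral classes *)

Section AffineGroup.
Local Open Scope ring_scope.
Variable K : finFieldType.

(** The coordinates (a0, a1, a2, u1, u2) stand for the affine map
    t |-> (a0 + a1 X + a2 X^2) + (1 + u1 X + u2 X^2) t of K[X]/(X^3). A record is
    used because products of fields already carry an additive group law. *)
Record affine := Affine { affine_coords : K * K * K * K * K }.

HB.instance Definition _ := [isNew for affine_coords].
HB.instance Definition _ := [Finite of affine by <:].

Definition affine_mul (g h : affine) :=
  let: Affine (a0, a1, a2, u1, u2) := g in
  let: Affine (b0, b1, b2, w1, w2) := h in
  Affine (a0 + b0, a1 + (b1 + u1 * b0), a2 + (b2 + u1 * b1 + u2 * b0),
          u1 + w1, u2 + w2 + u1 * w1).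

Definition affine_inv (g : affine) :=
  let: Affine (a0, a1, a2, u1, u2) := g in
  Affine (- a0, - (a1 - u1 * a0), - (a2 - u1 * a1 + (u1 ^+ 2 - u2) * a0),
          - u1, u1 ^+ 2 - u2).

Fact affine_mulA : associative affine_mul.
Proof.
move=> [[[[[a0 a1] a2] u1] u2]] [[[[[b0 b1] b2] v1] v2]] [[[[[c0 c1] c2] w1] w2]].
rewrite /=; congr (Affine (_, _, _, _, _)); ring.
Qed.

Fact affine_mul1 : left_id (Affine (0, 0, 0, 0, 0)) affine_mul.
Proof.
move=> [[[[[a0 a1] a2] u1] u2]].
rewrite /=; congr (Affine (_, _, _, _, _)); ring.
Qed.

Fact affine_mulV : left_inverse (Affine (0, 0, 0, 0, 0)) affine_inv affine_mul.
Proof.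
move=> [[[[[a0 a1] a2] u1] u2]].
rewrite /=; congr (Affine (_, _, _, _, _)); ring.
Qed.

HB.instance Definition _ := Finite_isGroup.Build affine
  affine_mulA affine_mul1 affine_mulV.

Lemma affine_mulE a0 a1 a2 u1 u2 b0 b1 b2 w1 w2 :
  (Affine (a0, a1, a2, u1, u2) * Affine (b0, b1, b2, w1, w2))%g =
  Affine (a0 + b0, a1 + (b1 + u1 * b0), a2 + (b2 + u1 * b1 + u2 * b0),
          u1 + w1, u2 + w2 + u1 * w1).
Proof. by []. Qed.

Lemma affine_invE a0 a1 a2 u1 u2 :
  (Affine (a0, a1, a2, u1, u2))^-1%g =
  Affine (- a0, - (a1 - u1 * a0), - (a2 - u1 * a1 + (u1 ^+ 2 - u2) * a0),
          - u1, u1 ^+ 2 - u2).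
Proof. by []. Qed.

Lemma card_affine : #|{: affine}| = (#|K| ^ 5)%N.
Proof.
rewrite (bij_eq_card (f := affine_coords)); last first.
  by exists Affine => [[]|].
by rewrite !card_prod !expnS expn0 muln1 !mulnA.
Qed.

(** The translation by m X^2; these translations form the center. *)
Definition zeta (m : K) : affine := Affine (0, 0, m, 0, 0).

Definition in_zeta (g : affine) :=
  let: Affine (a0, a1, a2, u1, u2) := g in [&& a0 == 0, a1 == 0, u1 == 0 & u2 == 0].

Lemma zeta0 : zeta 0 = 1%g. Proof. by []. Qed.

Lemma zetaD m n : zeta (m + n) = (zeta m * zeta n)%g.
Proof.
rewrite /zeta affine_mulE.
by congr (Affine (_, _, _, _, _)); ring.
Qed.

Lemma zetaV m : (zeta m)^-1%g = zeta (- m).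
Proof. by apply/eqP; rewrite eq_invg_mul -zetaD subrr. Qed.

Lemma in_zetaP g : reflect (exists m, g = zeta m) (in_zeta g).
Proof.
apply: (iffP idP) => [|[m ->]]; last by rewrite /= eqxx.
case: g => [[[[[a0 a1] a2] u1] u2]] /= /and4P[/eqP-> /eqP-> /eqP-> /eqP->].
by exists a2.
Qed.

(** The maps g = (a, u) and h = (b, w) satisfy gh = zeta m * hg if and only if
    (u - 1) b - (w - 1) a = m X^2. Unless a is a multiple of X^2 and u = 1, this has
    a solution with b or w - 1 a monomial, chosen according to the first nonzero
    coordinate of g among u1, u2, a0 and a1. *)
Lemma conj_noncentral g m : ~~ in_zeta g ->
  exists h, (g ^ h = zeta m * g)%g.
Proof.
suff ex : ~~ in_zeta g -> exists h, (g * h = h * (zeta m * g))%g.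
  by move=> /ex[h gh]; exists h; rewrite conjgE gh mulKg.
case: g => [[[[[a0 a1] a2] u1] u2]] /=.
have [u10|u10] := eqVneq u1 0; last first.
  exists (Affine (0, m / u1, 0, 0, 0)).
  by rewrite !affine_mulE; congr (Affine (_, _, _, _, _)); field.
have [u20|u20] := eqVneq u2 0; last first.
  exists (Affine (m / u2, 0, 0, 0, 0)); rewrite u10.
  by rewrite !affine_mulE; congr (Affine (_, _, _, _, _)); field.
have [a00|a00] := eqVneq a0 0; last first.
  exists (Affine (0, 0, 0, 0, - m / a0)); rewrite u10 u20.
  by rewrite !affine_mulE; congr (Affine (_, _, _, _, _)); field.
have [a10|a10] := eqVneq a1 0; first by [].
exists (Affine (0, 0, 0, - m / a1, 0)); rewrite u10 u20 a00.
by rewrite !affine_mulE; congr (Affine (_, _, _, _, _)); field.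
Qed.

End AffineGroup.

(** * Failure of central essentiality for the affine group *)

Section NotCentrallyEssential.
Local Open Scope ring_scope.
Variables (F : fieldType) (K : finFieldType).
Hypothesis natr_card0 : #|K|%:R = 0 :> F.
Local Notation gT := (affine K).
Local Notation A := (galg F gT).
Local Notation coef := (@galg_coef F gT).
Local Notation base := (@galg_base F gT).
Local Notation G := [set: gT]%G.

Definition zeta_sum : A := \sum_m base (zeta m).

Lemma zeta_inj : injective (@zeta K).
Proof. by move=> m n [->]. Qed.

Lemma in_zetaM m (g : gT) : in_zeta (zeta m * g)%g = in_zeta g.
Proof.
by case: g => [[[[[a0 a1] a2] u1] u2]]; rewrite affine_mulE /= !mul0r
  !(add0r, addr0).
Qed.

Lemma coef_zeta_sum_mul (u : A) g :
  coef (zeta_sum * u) g = \sum_m coef u (zeta m * g)%g.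
Proof.
rewrite mulr_suml.
rewrite (big_morph (fun w => coef w g) (fun u v => coefD u v g) (coef0 F g)).
rewrite (reindex_inj oppr_inj) /=; apply: eq_bigr => m _.
by rewrite coef_base_mul zetaV opprK.
Qed.

(** At a noncentral g all the elements zeta m * g are conjugate, so that the
    coefficient of the product is #|K| times that of c, that is, 0. *)
Lemma zeta_sum_mul_class_fun c : class_fun G c ->
  zeta_sum * c = (\sum_m coef c (zeta m)) *: zeta_sum.
Proof.
move=> cc; apply/galgP => g; rewrite coefZ -[in RHS](mulr1 zeta_sum).
rewrite !coef_zeta_sum_mul; have [/in_zetaP[n ->]|gZ] := boolP (in_zeta g).
  have tr (f : gT -> F) : \sum_m f (zeta m * zeta n)%g = \sum_m f (zeta m).
    rewrite [RHS](reindex_inj (addIr n)) /=.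
    by apply: eq_bigr => m _; rewrite zetaD.
  rewrite (tr (coef c)) (tr (coef 1)) [X in _ * X](bigD1 0) //= coef1 zeta0 eqxx.
  rewrite [X in 1 + X]big1 ?addr0 ?mulr1 // => m m0; rewrite coef1 -zeta0.
  by rewrite (inj_eq zeta_inj) (negbTE m0).
transitivity (\sum_(m : K) coef c g).
  apply: eq_bigr => m _; have [h <-] := conj_noncentral m gZ.
  by rewrite cc ?inE.
rewrite sumr_const -mulr_natr natr_card0 mulr0 [X in _ * X]big1 ?mulr0 // => m _.
rewrite coef1; case: eqP => // zg1.
by rewrite -(in_zetaM m) zg1 /= !eqxx in gZ.
Qed.

Definition translation1 : gT := Affine (1, 0, 0, 0, 0).
Definition homothety1X : gT := Affine (0, 0, 0, 1, 0).

(** The element r such that no rc with c central is both central and nonzero is the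
    sum of the coset of the translation by 1 modulo the center of the group. *)
Lemma not_ce_in_affine : ~ ce_in F G.
Proof.
have coef_r g : coef (zeta_sum * base translation1) g =
    \sum_m (zeta m * g == translation1)%g%:R.
  by rewrite coef_zeta_sum_mul; apply: eq_bigr => m _; rewrite coef_base.
have r1 : coef (zeta_sum * base translation1) translation1 = 1.
  rewrite coef_r (bigD1 0) //= zeta0 mul1g eqxx big1 ?addr0 // => m m0.
  rewrite -[in X in _ == X](mul1g translation1) (inj_eq (mulIg _)) -zeta0.
  by rewrite (inj_eq zeta_inj) (negbTE m0).
(* Conjugation by the homothety changes the coordinate of X of the translation
   by 1, which multiplication by zeta m does not affect. *)
have r0 : coef (zeta_sum * base translation1) (translation1 ^ homothety1X)%g = 0.
  rewrite coef_r big1 // => m _; case: eqP => //.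
  rewrite conjgE affine_invE !affine_mulE => -[_ + _ _ _].
  rewrite !(mul0r, mulr0, mulr1, subr0, addr0, add0r, oppr0, mul1r).
  by move/eqP; rewrite oppr_eq0 oner_eq0.
move=> /(_ (zeta_sum * base translation1))[g||c [_ cc rc0 rcC]].
- by rewrite inE.
- by apply/galg_neq0P; exists translation1; rewrite r1 oner_eq0.
have base_c : base translation1 * c = c * base translation1.
  by apply/esym/(class_fun_comm cc); apply: supported_base; rewrite inE.
(* The product is e times the element considered, with a nonzero scalar e. *)
move: rc0 rcC; rewrite -mulrA base_c mulrA zeta_sum_mul_class_fun // -scalerAl.
set e := \sum_m _ => er0 /(_ translation1 homothety1X (in_setT _)).
rewrite !coefZ r0 r1 mulr0 mulr1.
by move=> e0; rewrite -e0 scale0r eqxx in er0.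
Qed.

End NotCentrallyEssential.

(** * The three parts together *)

Theorem theorem1p1 (F : fieldType) (p : nat) (charFp : p \in [pchar F]%R) :
  [/\ (forall (gT : finGroupType) (G : {group gT}),
         centrally_essential (galg F (subg_of G)) <->
         exists P H : {group gT},
           [/\ P \x H = G, 'Syl_p(G) = [set P], abelian H &
               centrally_essential (galg F (subg_of P))]),
      (forall (gT : finGroupType) (G : {group gT}),
         p.-group G -> nil_class G <= 2 ->
         centrally_essential (galg F (subg_of G))) &
      (exists (gT : finGroupType) (G : {group gT}),
         #|G| = (p ^ 5)%N /\ ~ centrally_essential (galg F (subg_of G)))].
Proof.
have p_pr := pcharf_prime charFp.
split=> [gT G|gT G pG classG|].
- split=> [/ce_inP ceG|[P [H [defG _ abH /ce_inP ceP]]]]; last first.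
    by apply/ce_inP; apply: ce_in_dprod defG abH ceP.
  have [P [H [defG sylP abH]]] := central_p'elts_dprod p_pr
    (fun y yG => ce_in_p'elt_central charFp ceG yG).
  by exists P, H; split=> //; apply/ce_inP; apply: ce_in_dprodl defG ceG.
- by apply/ce_inP; apply: ce_in_class2 charFp pG classG.
- exists (affine 'F_p), [set: affine 'F_p]%G.
  split; first by rewrite cardsT card_affine card_Fp.
  by move/ce_inP; apply: not_ce_in_affine; rewrite card_Fp // (pcharf0 charFp).
Qed.
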